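(* For every $P_0\in\mathcal C_3^{\mathrm{nd}}$, the forward orbit $P_{k+1}=C(P_k)$, $k\ge 0$, is defined for all $k\ge 0$ and converges to one of the seven matrices $A(a,b,c)$ with $$(a,b,c)\in\Bigl\{\bigl(-\tfrac12,-\tfrac12,-\tfrac12\bigr),\ (1,-1,-1),\ (-1,1,-1),\ (-1,-1,1),\ (-1,0,0),\ (0,-1,0),\ (0,0,-1)\Bigr\},$$ which are fixed points of $C$.
   Context: For nonconstant $x,y\in\mathbb R^3$, with means $\bar x,\bar y$, the Pearson correlation is $\operatorname{corr}(x,y)=\frac{\sum_k(x_k-\bar x)(y_k-\bar y)}{\sqrt{\sum_k(x_k-\bar x)^2\sum_k(y_k-\bar y)^2}}$. For a real $3\times3$ matrix $A$ all of whose rows $r_1,r_2,r_3$ are nonconstant, $C(A)$ is the $3\times 3$ matrix with entries $[C(A)]_{ij}=\operatorname{corr}(r_i,r_j)$; a fixed point is such an $A$ with $C(A)=A$. $\mathcal C_3$ is the set of real symmetric positive semidefinite $3\times3$ matrices with unit diagonal, and $\mathcal C_3^{\mathrm{nd}}$ is the set of $P\in\mathcal C_3$ all of whose rows are nonconstant. For real $a,b,c$, $A(a,b,c)=\begin{pmatrix} 1 & a & b \\ a & 1 & c \\ b & c & 1 \end{pmatrix}$. *)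

(* Defs.v *)
From HB Require Import structures.
From mathcomp Require Import all_boot all_order all_algebra.
From mathcomp Require Import all_classical all_reals all_analysis.
Import Order.TTheory GRing.Theory Num.Theory.
Import numFieldNormedType.Exports.

Set Implicit Arguments.
Unset Strict Implicit.
Unset Printing Implicit Defensive.

Local Open Scope classical_set_scope.
Local Open Scope ring_scope.

Section Defs.
Variable R : realType.

Definition mean (x : 'rV[R]_3) : R := (\sum_k x 0 k) / 3.

Definition nonconstant (x : 'rV[R]_3) : Prop := exists k l, x 0 k <> x 0 l.

(* Meaningful only when x and y are nonconstant: otherwise the denominator is
   0 and the value is the junk value 0. *)
Definition corr (x y : 'rV[R]_3) : R :=
  (\sum_k (x 0 k - mean x) * (y 0 k - mean y)) /
  Num.sqrt ((\sum_k (x 0 k - mean x) ^+ 2) * (\sum_k (y 0 k - mean y) ^+ 2)).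

(* The domain of the partial map [corrmx]. *)
Definition nonconstant_rows (A : 'M[R]_3) : Prop :=
  forall i, nonconstant (row i A).

(* Totalized by the junk value of [corr]; to be used together with
   [nonconstant_rows]. *)
Definition corrmx (A : 'M[R]_3) : 'M[R]_3 :=
  \matrix_(i, j) corr (row i A) (row j A).

Definition fixed_point (A : 'M[R]_3) : Prop :=
  nonconstant_rows A /\ corrmx A = A.

Definition possemidef (A : 'M[R]_3) : Prop :=
  forall v : 'rV[R]_3, 0 <= (v *m A *m v^T) 0 0.

Definition C3 : set 'M[R]_3 :=
  [set P | [/\ P^T = P, possemidef P & forall i, P i i = 1]].

Definition C3nd : set 'M[R]_3 := C3 `&` [set P | nonconstant_rows P].

Definition Amx (a b c : R) : 'M[R]_3 :=
  \matrix_(i, j) nth 0 (nth [::] [:: [:: 1; a; b];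
                                     [:: a; 1; c];
                                     [:: b; c; 1]] i) j.

Definition limit_matrices : set 'M[R]_3 :=
  [set` [:: Amx (- 2^-1) (- 2^-1) (- 2^-1);
            Amx 1 (- 1) (- 1);
            Amx (- 1) 1 (- 1);
            Amx (- 1) (- 1) 1;
            Amx (- 1) 0 0;
            Amx 0 (- 1) 0;
            Amx 0 0 (- 1)]].

Definition corr_orbit (P0 : 'M[R]_3) (k : nat) : 'M[R]_3 := iter k corrmx P0.

End Defs.

(* Main.v *)
Require Import Defs.
From HB Require Import structures.
From mathcomp Require Import all_boot all_order all_algebra.
From mathcomp Require Import all_classical all_reals all_analysis.
From mathcomp Require Import ring lra.
Import Order.TTheory GRing.Theory Num.Theory.
Import numFieldNormedType.Exports.

Local Open Scope classical_set_scope.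
Local Open Scope ring_scope.

(** Write a unit-diagonal symmetric matrix as [A(1-z, 1-y, 1-x)] and follow the
three gaps [x], [y], [z] >= 0.  Centering a row projects it to the plane
orthogonal to (1,1,1); identify this plane with the complex numbers so that the
coordinate vectors go to a multiple of 1, w, w^2, where w is a primitive cube
root of unity.  Up to a common factor the centered rows are
z w + y w^2, z + x w^2 and y + x w, so all inner products are quadratic forms in
the gaps, and the correlation map becomes the map
(x, y, z) |-> (gap x y z, gap y x z, gap z x y).

This map commutes with permutations and preserves the order of the gaps, so one
may assume x <= y <= z; then y > 0 because the rows are nonconstant.
 - If x < y, the key estimate [gap_contraction], that is
   x'/y' <= (x/y) (1 + x/y)/2, forces x/y -> 0 geometrically, hence x -> 0.
   After one step the matrix is the Gram matrix of three unit vectors of a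
   plane, so its determinant vanishes ([gap_circle]): (z - y)^2 is then at most
   8x.  Thus the rows 1 and 2 become opposite, as do the rows 1 and 3, and the
   gaps tend to (0, 2, 2) ([gap_orbit_strict]).
 - If x = y < z, then z = 2x(2-x) after one step, and b = 1 - x evolves by
   b |-> b / sqrt(4 b^2 + 6 b + 3).  Since b > -1/2 the denominator stays above
   a constant > 1, so b -> 0 and the gaps tend to (1, 1, 2)
   ([gap_orbit_tie]).
 - If x = y = z, one step leads to the fixed point (3/2, 3/2, 3/2).
Undoing the permutation gives the seven limits. *)

Ltac nonneg :=
  repeat first [assumption | exact: ler0n | apply: addr_ge0 | apply: mulr_ge0 |
                apply: exprn_ge0 | apply: sqr_ge0 | by []].

Section GapDynamics.
Variable R : realType.
Implicit Types x y z : R.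

(** * The correlation map in terms of gaps *)

(** The squared modulus of y + z w (the Eisenstein norm), and the inner product
of y + x w with z + x w^2: up to the factor 2/3, the inner products of centered
rows.  Thus gap x y z is the new gap of the two rows whose gap is x and whose
gaps to the remaining row are y and z. *)
Definition eisn y z : R := y ^+ 2 - y * z + z ^+ 2.
Definition eisdot x y z : R := y * z - x * (x + y + z) / 2.
Definition gap x y z : R :=
  1 - eisdot x y z / (Num.sqrt (eisn x y) * Num.sqrt (eisn x z)).

Lemma eisnC y z : eisn y z = eisn z y.
Proof. by rewrite /eisn; ring. Qed.

Lemma gapC x y z : gap x y z = gap x z y.
Proof.
rewrite /gap [Num.sqrt _ * _]mulrC; congr (1 - _ / _).
by rewrite /eisdot; field.
Qed.

Lemma eisn_gt0 {y z} : 0 <= y -> 0 <= z -> 0 < y + z -> 0 < eisn y z.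
Proof.
move=> y0 z0 yz0; have : 0 < (y + z) ^+ 2 by rewrite exprn_gt0.
have := sqr_ge0 (y - z); rewrite /eisn; nra.
Qed.

(** Lagrange's identity |u|^2 |v|^2 = <u, v>^2 + det(u, v)^2 for the vectors
u = y + x w and v = z + x w^2. *)
Lemma eis_lagrange x y z :
  eisn x y * eisn x z - eisdot x y z ^+ 2 = 3 / 4 * (x * (y + z - x)) ^+ 2.
Proof. by rewrite /eisn /eisdot; field. Qed.

Lemma sqrt_eisn {x y} (x0 : 0 <= x) (y0 : 0 <= y) (xy0 : 0 < x + y) :
  0 < Num.sqrt (eisn x y) /\ Num.sqrt (eisn x y) ^+ 2 = eisn x y.
Proof.
have n0 := eisn_gt0 x0 y0 xy0.
by rewrite sqrtr_gt0 sqr_sqrtr ?ltW.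
Qed.

Lemma gapM {x y z} : 0 <= x -> 0 <= y -> 0 <= z -> 0 < x + y -> 0 < x + z ->
  gap x y z * (Num.sqrt (eisn x y) * Num.sqrt (eisn x z)) =
  Num.sqrt (eisn x y) * Num.sqrt (eisn x z) - eisdot x y z.
Proof.
move=> x0 y0 z0 xy0 xz0; rewrite /gap mulrBl mul1r divfK //.
have [s0 _] := sqrt_eisn x0 y0 xy0; have [q0 _] := sqrt_eisn x0 z0 xz0.
by rewrite mulf_neq0 ?gt_eqF.
Qed.

(** If gap = 1 - cos t then gap (2 - gap) = sin^2 t, which is computed by
[eis_lagrange] without any square root. *)
Lemma gap_sine {x y z} : 0 <= x -> 0 <= y -> 0 <= z -> 0 < x + y -> 0 < x + z ->
  gap x y z * (2 - gap x y z) * (eisn x y * eisn x z) =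
  3 / 4 * (x * (y + z - x)) ^+ 2.
Proof.
move=> x0 y0 z0 xy0 xz0; rewrite -eis_lagrange.
have [s0 s2] := sqrt_eisn x0 y0 xy0; have [q0 q2] := sqrt_eisn x0 z0 xz0.
have := gapM x0 y0 z0 xy0 xz0; move: s0 s2 q0 q2.
set s := Num.sqrt _; set q := Num.sqrt _ => s0 s2 q0 q2 gE.
rewrite -s2 -q2 -exprMn; set g := gap x y z in gE *.
have -> : eisdot x y z = s * q - g * (s * q) by rewrite gE; ring.
by ring.
Qed.

Lemma gap_ge0_le2 {x y z} :
  0 <= x -> 0 <= y -> 0 <= z -> 0 < x + y -> 0 < x + z -> 0 <= gap x y z <= 2.
Proof.
move=> x0 y0 z0 xy0 xz0; have := gap_sine x0 y0 z0 xy0 xz0.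
set g := gap x y z; set r := 3 / 4 * _ => gE.
have r0 : 0 <= r by rewrite mulr_ge0 ?sqr_ge0 //; lra.
have n0 : 0 < eisn x y * eisn x z by rewrite mulr_gt0 // eisn_gt0.
have : 0 <= g * (2 - g) by rewrite -(pmulr_lge0 _ n0) gE.
by move=> h; apply/andP; split; nra.
Qed.

(** * Ordered gaps *)

Definition ordered x y z := [/\ 0 <= x, x <= y, y <= z & 0 < y].

Lemma gap_gt0_middle {x y z} : ordered x y z -> 0 < gap y x z.
Proof.
case=> x0 xy yz y0; have z0 : 0 < z by lra.
have yx0 : 0 < y + x by lra.
have yz0 : 0 < y + z by lra.
have [s0 s2] := sqrt_eisn (ltW y0) x0 yx0.
have [p0 p2] := sqrt_eisn (ltW y0) (ltW z0) yz0.
have := gapM (ltW y0) x0 (ltW z0) yx0 yz0; move: s0 s2 p0 p2.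
set s := Num.sqrt _; set p := Num.sqrt _ => s0 s2 p0 p2 gE.
have n0 : 0 < s * p by rewrite mulr_gt0.
rewrite -(pmulr_lgt0 _ n0) gE subr_gt0.
have := eis_lagrange y x z; rewrite -s2 -p2 -exprMn.
set n := s * p in n0 *; set d := eisdot y x z => nE.
case: (ltrP d 0) => [d0|d0]; first by lra.
have w0 : 0 < x + z - y.
  case: (ltrP 0 x) => [xp|xn]; first by lra.
  have x00 : x = 0 by lra.
  move: d0; rewrite /d /eisdot x00; nra.
have : 0 < (y * (x + z - y)) ^+ 2 by rewrite exprn_gt0 // mulr_gt0.
nra.
Qed.

(** The inner product of the rows 1 and 2 is nonpositive.  If that of the rows 1
and 3 is negative too, squaring removes the square roots, and the difference is
a polynomial with nonnegative coefficients in x, y - x and z - y. *)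
Lemma gap_middle_le_last {x y z} : ordered x y z -> gap y x z <= gap z x y.
Proof.
case=> x0 xy yz y0; have z0 : 0 < z by lra.
have xz0 : 0 < x + z by lra.
have xy0 : 0 < x + y by lra.
have yz0 : 0 < y + z by lra.
rewrite /gap (eisnC y x) (eisnC z x) (eisnC z y) lerD2l lerN2.
have [s0 s2] := sqrt_eisn x0 (ltW y0) xy0.
have [q0 q2] := sqrt_eisn x0 (ltW z0) xz0.
have [p0 p2] := sqrt_eisn (ltW y0) (ltW z0) yz0.
move: s0 s2 q0 q2 p0 p2.
set s := Num.sqrt (eisn x y); set q := Num.sqrt (eisn x z).
set p := Num.sqrt (eisn y z) => s0 s2 q0 q2 p0 p2.
rewrite !invfM [_ * (q^-1 * _)]mulrA [_ * (s^-1 * _)]mulrA.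
rewrite ler_pM2r ?invr_gt0 //.
rewrite ler_pdivrMr // mulrAC ler_pdivlMr //.
have last0 : eisdot z x y <= 0 by rewrite /eisdot; nra.
have [mid0|mid0] := lerP 0 (eisdot y x z).
  apply: (@le_trans _ _ 0); last by rewrite mulr_ge0 // ltW.
  by rewrite mulr_le0_ge0 // ltW.
suff: (- eisdot y x z * q) ^+ 2 <= (- eisdot z x y * s) ^+ 2.
  rewrite ler_sqr; first by rewrite !mulNr lerN2.
    by rewrite nnegrE mulr_ge0 ?oppr_ge0 // ltW.
  by rewrite nnegrE mulr_ge0 ?oppr_ge0 // ltW.
rewrite -subr_ge0 !exprMn s2 q2 !sqrrN.
have [u [v [u0 v0 yE zE]]] : exists u v,
    [/\ 0 <= u, 0 <= v, y = x + u & z = x + u + v].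
  by exists (y - x), (z - y); split; [lra|lra|ring|ring].
have -> : (eisdot z x y) ^+ 2 * eisn x y - (eisdot y x z) ^+ 2 * eisn x z =
  3 / 4 * (x * v) * (3 * x ^+ 4 + 12 * x ^+ 3 * u + 6 * x ^+ 3 * v
    + 17 * x ^+ 2 * u ^+ 2 + 17 * x ^+ 2 * u * v + 3 * x ^+ 2 * v ^+ 2
    + 12 * x * u ^+ 3 + 18 * x * u ^+ 2 * v + 6 * x * u * v ^+ 2
    + 4 * u ^+ 4 + 8 * u ^+ 3 * v + 5 * u ^+ 2 * v ^+ 2 + u * v ^+ 3).
  by rewrite yE zE /eisdot /eisn; field.
nonneg.
Qed.

(** The estimate x'/y' <= (x/y) (1 + x/y)/2.  Both sides agree for x = y
whatever z is, so no cruder bound on the square roots survives there: the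
factor y - x has to be extracted exactly.  Multiplying by p + q makes this
possible, where p and q are the moduli that distinguish the two denominators, as
p^2 - q^2 is divisible by y - x.  The cofactor is then bounded below by a
polynomial with nonnegative coefficients in x, y - x and z - y. *)
Lemma gap_contraction {x y z} : ordered x y z ->
  gap x y z * (2 * y ^+ 2) <= gap y x z * (x * (x + y)).
Proof.
case=> x0 xy yz y0; have z0 : 0 < z by lra.
have xz0 : 0 < x + z by lra.
have xy0 : 0 < x + y by lra.
have yz0 : 0 < y + z by lra.
have yx0 : 0 < y + x by lra.
have gx := gapM x0 (ltW y0) (ltW z0) xy0 xz0.
have gy := gapM (ltW y0) x0 (ltW z0) yx0 yz0.
rewrite (eisnC y x) in gy.
have [s0 s2] := sqrt_eisn x0 (ltW y0) xy0.
have [q0 q2] := sqrt_eisn x0 (ltW z0) xz0.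
have [p0 p2] := sqrt_eisn (ltW y0) (ltW z0) yz0.
move: gx gy s0 s2 q0 q2 p0 p2; set X := gap x y z; set Y := gap y x z.
set s := Num.sqrt (eisn x y); set q := Num.sqrt (eisn x z).
set p := Num.sqrt (eisn y z) => gx gy s0 s2 q0 q2 p0 p2.
have n0 : 0 < s * q * p * (p + q) by rewrite !mulr_gt0 // addr_gt0.
rewrite -(ler_pM2r n0) -subr_ge0.
set M := eisdot x y z in gx; set N := eisdot y x z in gy.
(* K is the quotient by y - x of 2 y^2 M - x (x + y) N, which vanishes at
   y = x. *)
pose K : R := (z * (4 * y ^+ 2 + 3 * x * y + 2 * x ^+ 2) - x * y * (x + y)) / 2.
have -> : Y * (x * (x + y)) * (s * q * p * (p + q)) -
          X * (2 * y ^+ 2) * (s * q * p * (p + q)) =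
  (y - x) * ((p * (p + q)) * (K - q * s * (2 * y + x))
             - x * (x + y) * N * (z - x - y)).
  have -> : Y * (x * (x + y)) * (s * q * p * (p + q)) =
    (Y * (s * p)) * (x * (x + y)) * q * (p + q) by ring.
  have -> : X * (2 * y ^+ 2) * (s * q * p * (p + q)) =
    (X * (s * q)) * (2 * y ^+ 2) * p * (p + q) by ring.
  rewrite gx gy.
  have KE : (y - x) * K = 2 * y ^+ 2 * M - x * (x + y) * N.
    by rewrite /K /M /N /eisdot; field.
  have qp : (y - x) * (z - x - y) = q ^+ 2 - p ^+ 2.
    by rewrite q2 p2 /eisn; ring.
  rewrite mulrBr.
  have -> : (y - x) * (x * (x + y) * N * (z - x - y)) =
    x * (x + y) * N * (q ^+ 2 - p ^+ 2) by rewrite -qp; ring.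
  have -> : (y - x) * (p * (p + q) * (K - q * s * (2 * y + x))) =
    p * (p + q) * (2 * y ^+ 2 * M - x * (x + y) * N
       - (y - x) * (q * s * (2 * y + x))) by rewrite -KE; ring.
  by ring.
apply: mulr_ge0; first by rewrite subr_ge0.
(* AM-GM in the form 2 z q <= z^2 + q^2, sharp both at x = 0 and at x = z, where
   q = z. *)
have qs : 4 * (y * z) * (q * s) <= (z ^+ 2 + eisn x z) * (y ^+ 2 + eisn x y).
  have -> : 4 * (y * z) * (q * s) = (2 * z * q) * (2 * y * s) by ring.
  have am (c d : R) : 2 * c * d <= c ^+ 2 + d ^+ 2.
    by have := sqr_ge0 (c - d); nra.
  by rewrite -q2 -s2 ler_pM ?am // !mulr_ge0 ?ltW.
(* The modulus of c + d w is at least (c + d)/2, with equality for c = d. *)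
have pq : eisn y z + (y + z) * (x + z) / 4 <= p * (p + q).
  have half (c d e : R) : 0 <= c -> 0 <= d -> 0 <= e -> e ^+ 2 = eisn c d ->
    (c + d) / 2 <= e.
    move=> c0 d0 e0 eE; rewrite -ler_sqr ?nnegrE ?eE /eisn; try lra.
    by have := sqr_ge0 (c - d); nra.
  have hp := half y z p (ltW y0) (ltW z0) (ltW p0) p2.
  have hq := half x z q x0 (ltW z0) (ltW q0) q2.
  have pp : 0 <= (y + z) / 2 by lra.
  have qq : 0 <= (x + z) / 2 by lra.
  by have := ler_pM pp qq hp hq; rewrite [p * (p + q)]mulrDr -expr2 p2; lra.
set B := _ + _ in pq.
have [u [v [u0 v0 yE zE]]] : exists u v,
    [/\ 0 <= u, 0 <= v, y = x + u & z = x + u + v].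
  by exists (y - x), (z - y); split; [lra|lra|ring|ring].
have yz4 : 0 < 4 * (y * z) by rewrite !mulr_gt0.
have B0 : 0 <= B.
  by rewrite /B addr_ge0 ?divr_ge0 ?mulr_ge0 // ltW // eisn_gt0 // ltW.
pose F : R := 4 * (y * z) * K
  - (z ^+ 2 + eisn x z) * (y ^+ 2 + eisn x y) * (2 * y + x).
have F0 : 0 <= F.
  have -> : F = x * (2 * x ^+ 4 + 18 * x ^+ 3 * u + 14 * x ^+ 3 * v
    + 35 * x ^+ 2 * u ^+ 2 + 43 * x ^+ 2 * u * v + 6 * x ^+ 2 * v ^+ 2
    + 28 * x * u ^+ 3 + 44 * x * u ^+ 2 * v + 14 * x * u * v ^+ 2
    + 8 * u ^+ 4 + 14 * u ^+ 3 * v + 6 * u ^+ 2 * v ^+ 2).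
    by rewrite /F /K yE zE /eisn; field.
  nonneg.
have G0 : 0 <= B * F - 4 * (y * z) * (x * (x + y) * N * (z - x - y)).
  have -> : B * F - 4 * (y * z) * (x * (x + y) * N * (z - x - y)) =
    x / 4 * (84 * x ^+ 5 * u + 144 * x ^+ 5 * v + 360 * x ^+ 4 * u ^+ 2
    + 738 * x ^+ 4 * u * v + 186 * x ^+ 4 * v ^+ 2 + 638 * x ^+ 3 * u ^+ 3
    + 1508 * x ^+ 3 * u ^+ 2 * v + 784 * x ^+ 3 * u * v ^+ 2
    + 102 * x ^+ 3 * v ^+ 3 + 578 * x ^+ 2 * u ^+ 4
    + 1543 * x ^+ 2 * u ^+ 3 * v + 1212 * x ^+ 2 * u ^+ 2 * v ^+ 2
    + 361 * x ^+ 2 * u * v ^+ 3 + 30 * x ^+ 2 * v ^+ 4 + 264 * x * u ^+ 5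
    + 784 * x * u ^+ 4 * v + 816 * x * u ^+ 3 * v ^+ 2
    + 382 * x * u ^+ 2 * v ^+ 3 + 70 * x * u * v ^+ 4 + 48 * u ^+ 6
    + 156 * u ^+ 5 * v + 198 * u ^+ 4 * v ^+ 2 + 120 * u ^+ 3 * v ^+ 3
    + 30 * u ^+ 2 * v ^+ 4).
    by rewrite /F /K /B /N /eisdot yE zE /eisn; field.
  nonneg.
have EF : F <= 4 * (y * z) * (K - q * s * (2 * y + x)).
  have : 4 * (y * z) * (q * s) * (2 * y + x) <=
    (z ^+ 2 + eisn x z) * (y ^+ 2 + eisn x y) * (2 * y + x).
    by rewrite ler_wpM2r //; lra.
  by rewrite /F; lra.
rewrite -(pmulr_rge0 _ yz4) mulrBr; apply: le_trans G0 _.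
rewrite lerD2r mulrCA; apply: ler_pM => //.
Qed.

(** The gaps after one step come from three unit vectors of a plane, whose Gram
matrix is singular; this is its vanishing determinant written in gaps. *)
Lemma gap_circle {x y z} : ordered x y z ->
  (gap z x y - gap y x z) ^+ 2 =
  gap x y z * (2 * gap y x z + 2 * gap z x y - gap x y z
                 - 2 * gap y x z * gap z x y).
Proof.
case=> x0 xy yz y0; have z0 : 0 < z by lra.
have xz0 : 0 < x + z by lra.
have xy0 : 0 < x + y by lra.
have yz0 : 0 < y + z by lra.
have [s0 s2] := sqrt_eisn x0 (ltW y0) xy0.
have [q0 q2] := sqrt_eisn x0 (ltW z0) xz0.
have [p0 p2] := sqrt_eisn (ltW y0) (ltW z0) yz0.
rewrite /gap (eisnC y x) (eisnC z x) (eisnC z y).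
move: s0 s2 q0 q2 p0 p2; set s := Num.sqrt (eisn x y).
set q := Num.sqrt (eisn x z); set p := Num.sqrt (eisn y z).
move=> s0 s2 q0 q2 p0 p2.
set c := _ / (s * q); set b := _ / (s * p); set a := _ / (q * p).
have cE : c * (s * q) = eisdot x y z by rewrite divfK // gt_eqF ?mulr_gt0.
have bE : b * (s * p) = eisdot y x z by rewrite divfK // gt_eqF ?mulr_gt0.
have aE : a * (q * p) = eisdot z x y by rewrite divfK // gt_eqF ?mulr_gt0.
apply/eqP; rewrite -subr_eq0.
have n0 : (s * q * p) ^+ 2 != 0 by rewrite gt_eqF ?exprn_gt0 ?mulr_gt0.
rewrite -(inj_eq (mulIf n0)) mul0r; apply/eqP.
transitivity (- (s ^+ 2 * q ^+ 2 * p ^+ 2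
   + 2 * (c * (s * q)) * (b * (s * p)) * (a * (q * p))
   - (a * (q * p)) ^+ 2 * s ^+ 2 - (b * (s * p)) ^+ 2 * q ^+ 2
   - (c * (s * q)) ^+ 2 * p ^+ 2)); first by ring.
by rewrite aE bE cE s2 q2 p2 /eisdot /eisn; field.
Qed.

(** That the first gap stays below the second is read off [gap_contraction],
since x (x + y) <= 2 y^2. *)
Lemma ordered_gap {x y z} : ordered x y z ->
  ordered (gap x y z) (gap y x z) (gap z x y).
Proof.
move=> o; have Y0 := gap_gt0_middle o.
have YZ := gap_middle_le_last o; have := gap_contraction o.
case: o => x0 xy yz y0.
have z0 : 0 <= z by lra.
have xz0 : 0 < x + z by lra.
have xy0 : 0 < x + y by lra.
have /andP[X0 _] := gap_ge0_le2 x0 (ltW y0) z0 xy0 xz0.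
move=> c; split=> //.
have y2 : 0 < 2 * y ^+ 2 by rewrite mulr_gt0 // exprn_gt0.
rewrite -(ler_pM2r y2); apply: le_trans c _; rewrite ler_pM2l //; nra.
Qed.

(** This lower bound keeps the three gaps from tending to 0 together. *)
Lemma gap_middle_ge1 {x y z} : ordered x y z -> 2 * x <= y ->
  1 <= gap y x z.
Proof.
case=> x0 xy yz y0 x2y; rewrite /gap lerBrDl gerDr.
apply: mulr_le0_ge0; first by rewrite /eisdot; nra.
by rewrite invr_ge0 mulr_ge0 // sqrtr_ge0.
Qed.

(** The angle t between the first and third rows satisfies
sin^2 t <= (x + z - y)^2 and cos t <= 0, so that 1 + cos t <= (x + z - y)^2;
the determinant relation bounds the latter by a multiple of x. *)
Lemma gap_middle_near2 {x y z} : ordered x y z -> z <= 2 -> 1 <= y ->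
  2 * x <= y -> (z - y) ^+ 2 = x * (2 * y + 2 * z - x - 2 * y * z) ->
  2 - gap y x z <= 20 * x.
Proof.
move=> o z2 y1 x2y circ; have Y1 := gap_middle_ge1 o x2y.
case: o => x0 xy yz y0.
have z0 : 0 <= z by lra.
have yx0 : 0 < y + x by lra.
have yz0 : 0 < y + z by lra.
have /andP[_ Y2] := gap_ge0_le2 (ltW y0) x0 z0 yx0 yz0.
have := gap_sine (ltW y0) x0 z0 yx0 yz0.
move: Y1 Y2; set Y := gap y x z => Y1 Y2 sineY.
have y2 : 0 < 3 / 4 * y ^+ 2 by rewrite mulr_gt0 ?exprn_gt0 //; lra.
have e1 : 3 / 4 * y ^+ 2 <= eisn y x.
  by have := sqr_ge0 (y - 2 * x); rewrite /eisn; nra.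
have e2 : 1 <= eisn y z.
  have yy : 1 <= y ^+ 2 by rewrite exprn_ege1.
  have zz : 0 <= z * (z - y) by rewrite mulr_ge0 // subr_ge0.
  by rewrite /eisn; lra.
have e12 : 3 / 4 * y ^+ 2 <= eisn y x * eisn y z.
  by apply: le_trans e1 _; rewrite ler_peMr // ltW // eisn_gt0 // ltW.
apply: (@le_trans _ _ ((x + z - y) ^+ 2)).
  rewrite -(ler_pM2r y2).
  apply: (@le_trans _ _ (Y * (2 - Y) * (eisn y x * eisn y z))).
    by apply: ler_pM => //; nra.
  by rewrite sineY exprMn; lra.
have yz4 : 0 <= y * z by nra.
have zy8 : (z - y) ^+ 2 <= 8 * x by rewrite circ; nra.
have := sqr_ge0 (x - (z - y)); nra.
Qed.

(** * Orbits with a strictly smallest gap *)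

Lemma cvg_succ (u : nat -> R) (l : R) :
  u k.+1 @[k --> \oo] --> l <-> u k @[k --> \oo] --> l.
Proof. by rewrite -[X in _ <-> X]cvg_shiftS. Qed.

Definition gap_orbit (x y z : nat -> R) := forall k,
  [/\ x k.+1 = gap (x k) (y k) (z k), y k.+1 = gap (y k) (x k) (z k)
    & z k.+1 = gap (z k) (x k) (y k)].

Lemma gap_orbit_ordered {x y z : nat -> R} : gap_orbit x y z ->
  ordered (x 0) (y 0) (z 0) -> forall k, ordered (x k) (y k) (z k).
Proof.
move=> orb o; elim=> // k IHk; have [-> -> ->] := orb k.
exact: ordered_gap.
Qed.

(** The ratio r = x/y does not increase, so every step multiplies it by at most
(1 + r)/2 for its initial value r. *)
Lemma geometric_bound {x y z : nat -> R} : gap_orbit x y z ->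
  ordered (x 0) (y 0) (z 0) -> x 0 < y 0 ->
  exists2 q : R, 0 <= q < 1 & forall k, x k <= q ^+ k * y k.
Proof.
move=> orb o0 xy0; have o := gap_orbit_ordered orb o0.
case: (o0) => x0 _ _ y0.
pose r := x 0 / y 0; pose q := (1 + r) / 2.
have r0 : 0 <= r by rewrite divr_ge0 // ltW.
have r1 : r < 1 by rewrite ltr_pdivrMr // mul1r.
exists q; first by rewrite /q; lra.
suff H : forall k, x k <= r * q ^+ k * y k.
  move=> k; have [? ? ? y0k] := o k; apply: le_trans (H k) _.
  by rewrite ler_pM2r // ler_piMl ?exprn_ge0 /q //; lra.
elim=> [|k IHk]; first by rewrite expr0 mulr1 divfK // gt_eqF.
have ok := o k; have := o k.+1; have [-> -> _] := orb k.
move: (gap_contraction ok); set X := gap _ _ _; set Y := gap _ _ _.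
case: ok => xk0 _ _ yk0 contr [_ _ _ Y0]; rewrite exprS.
set rho := r * q ^+ k in IHk.
have rho0 : 0 <= rho by rewrite mulr_ge0 // exprn_ge0 // /q; lra.
have rhor : rho <= r.
  by rewrite ler_piMr // exprn_ile1 // /q; lra.
have y2 : 0 < 2 * y k ^+ 2 by rewrite mulr_gt0 // exprn_gt0.
rewrite -(ler_pM2r y2); apply: le_trans contr _.
have -> : r * (q * q ^+ k) * Y * (2 * y k ^+ 2) =
          Y * ((rho * y k) * ((1 + r) * y k)) by rewrite /rho /q; field.
rewrite ler_pM2l //; apply: ler_pM => //; first by lra.
have : rho * y k <= r * y k by rewrite ler_pM2r.
by lra.
Qed.

Lemma gap_orbit_le2 {x y z : nat -> R} : gap_orbit x y z ->
  ordered (x 0) (y 0) (z 0) -> forall k, z k.+1 <= 2.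
Proof.
move=> orb o0 k; have [_ _ ->] := orb k.
have [x0 xy yz y0] := gap_orbit_ordered orb o0 k.
have z0 : 0 <= z k by lra.
have zx0 : 0 < z k + x k by lra.
have zy0 : 0 < z k + y k by lra.
by have /andP[] := gap_ge0_le2 z0 x0 (ltW y0) zx0 zy0.
Qed.

Lemma gap_orbit_strict {x y z : nat -> R} : gap_orbit x y z ->
  ordered (x 0) (y 0) (z 0) -> x 0 < y 0 ->
  [/\ x k @[k --> \oo] --> (0 : R), y k @[k --> \oo] --> (2 : R)
    & z k @[k --> \oo] --> (2 : R)].
Proof.
move=> orb o0 xy0; have o := gap_orbit_ordered orb o0.
have z2 := gap_orbit_le2 orb o0.
have [q /andP[q0 q1] xq] := geometric_bound orb o0 xy0.
have qk0 : q ^+ k @[k --> \oo] --> (0 : R).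
  by apply: cvg_expr; rewrite ger0_norm.
have y2 k : y k.+1 <= 2.
  by have [_ _ yz _] := o k.+1; apply: le_trans yz (z2 k).
have xlim : x k @[k --> \oo] --> (0 : R).
  apply/cvg_succ.
  apply: (@squeeze_cvgr _ _ _ _ (cst 0) (fun k => 2 * q ^+ k.+1)).
  - near=> k; have [x0 _ _ y0] := o k.+1; rewrite /cst x0 /=.
    apply: le_trans (xq k.+1) _; rewrite mulrC ler_wpM2r ?exprn_ge0 //.
  - exact: cvg_cst.
  - rewrite -[X in _ --> X](mulr0 2); apply: cvgMr.
    by apply/(cvg_succ (fun k => q ^+ k)).
have ylim : y k @[k --> \oo] --> (2 : R).
  apply/cvg_succ; apply/(cvg_succ (fun k => y k.+1)).
  apply: (@squeeze_cvgr _ _ _ _ (fun k => 2 - 20 * x k.+1) (cst 2)).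
  - (* Two shifts: the first puts the gaps on the determinant relation and
     makes y >= 1, the second brings y close to 2. *)
    near=> k; rewrite /cst y2 andbT lerBlDr -lerBlDl.
    have half m : q ^+ m <= 1 / 2 -> 2 * x m <= y m.
      by move=> qm; have [_ _ _ ym0] := o m; have := xq m; nra.
    have qk : q ^+ k <= 1 / 2.
      near: k; apply: (cvgr_le (0 : R)) => //; lra.
    have qk1 : q ^+ k.+1 <= 1 / 2.
      by rewrite exprS; apply: le_trans qk; rewrite ler_piMl ?exprn_ge0 // ltW.
    have [_ -> _] := orb k.+1; apply: gap_middle_near2 => //.
    + by have [_ -> _] := orb k; apply: gap_middle_ge1 => //; apply: half.
    + exact: half.
    + by have [-> -> ->] := orb k; exact: gap_circle.
  - rewrite -[X in _ --> X](subr0 2) -[X in _ --> _ - X](mulr0 20).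
    apply: cvgB; first exact: cvg_cst.
    by apply: cvgMr; apply/(cvg_succ x).
  - exact: cvg_cst.
split=> //.
apply/cvg_succ.
apply: (@squeeze_cvgr _ _ _ _ (fun k => y k.+1) (cst 2)).
- by near=> k; rewrite z2 andbT; have [] := o k.+1.
- by apply/(cvg_succ y).
- exact: cvg_cst.
Unshelve. all: by end_near. Qed.

(** * Orbits with equal smallest gaps *)

Lemma gap_equal {x} : 0 < x -> gap x x x = 3 / 2.
Proof.
move=> x0; have e : eisn x x = x ^+ 2 by rewrite /eisn; ring.
rewrite /gap e sqrtr_sqr ger0_norm ?ltW // /eisdot.
by field; rewrite gt_eqF.
Qed.

Lemma gap_tie_leg {x z} : 0 < x ->
  gap x x z = 1 - (z - 2 * x) / (2 * Num.sqrt (eisn x z)).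
Proof.
move=> x0; have e : eisn x x = x ^+ 2 by rewrite /eisn; ring.
rewrite /gap e sqrtr_sqr ger0_norm ?ltW //; congr (1 - _).
have [->|q0] := eqVneq (Num.sqrt (eisn x z)) 0.
  by rewrite !mulr0 invr0 !mulr0.
by rewrite /eisdot; field; rewrite q0 gt_eqF.
Qed.

(** The double-angle formula: after one step, row 3 makes the same angle t with
the rows 1 and 2, on opposite sides, so these make the angle 2t, and
1 - cos 2t = 2 sin^2 t. *)
Lemma gap_tie_base {x z} : 0 < x -> 0 <= z ->
  gap z x x = 2 * gap x x z * (2 - gap x x z).
Proof.
move=> x0 z0; have xx0 : 0 < x + x by lra.
have xz0 : 0 < x + z by lra.
have zx0 : 0 < z + x by lra.
have n0 := eisn_gt0 (ltW x0) z0 xz0.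
have := gap_sine (ltW x0) (ltW x0) z0 xx0 xz0.
have := gapM z0 (ltW x0) (ltW x0) zx0 zx0.
have [_] := sqrt_eisn z0 (ltW x0) zx0.
rewrite (eisnC z x); set q := Num.sqrt _ => q2; rewrite -expr2 q2 => base leg.
have e : eisn x x = x ^+ 2 by rewrite /eisn; ring.
move: leg; rewrite e => leg.
have n1 : x ^+ 2 * eisn x z != 0 by rewrite gt_eqF ?mulr_gt0 ?exprn_gt0.
apply: (mulIf n1).
have -> : gap z x x * (x ^+ 2 * eisn x z) =
  gap z x x * eisn x z * x ^+ 2 by ring.
have -> : 2 * gap x x z * (2 - gap x x z) * (x ^+ 2 * eisn x z) =
  2 * (gap x x z * (2 - gap x x z) * (x ^+ 2 * eisn x z)) by ring.
by rewrite base leg /eisdot /eisn; field.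
Qed.

(** In terms of b = 1 - x, the orbit stays on the side b > -1/2 of the
equilateral fixed point. *)
Lemma gap_tie_lt {x z} : 0 < x -> x < z -> gap x x z < 3 / 2.
Proof.
move=> x0 xz; rewrite gap_tie_leg //.
have z0 : 0 <= z by lra.
have xz0 : 0 < x + z by lra.
have [] := sqrt_eisn (ltW x0) z0 xz0; set q := Num.sqrt _ => q0 q2.
rewrite ltrBlDr -ltrBlDl ltr_pdivlMr ?mulr_gt0 //.
have [?|zx] := lerP (2 * x) z; first by nra.
suff : 2 * x - z < q by lra.
rewrite -ltr_sqr ?nnegrE; try lra.
rewrite q2 /eisn; nra.
Qed.

(** On the curve z = 2 x (2 - x), which contains the orbit after one step, the
map is one-dimensional in b = 1 - x. *)
Lemma gap_tie_step {x} : 0 < x -> x < 3 / 2 ->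
  1 - gap x x (2 * x * (2 - x)) =
  (1 - x) / Num.sqrt (4 * (1 - x) ^+ 2 + 6 * (1 - x) + 3).
Proof.
move=> x0 x32; rewrite gap_tie_leg //.
set d := 4 * _ + _ + _.
have d0 : 0 < d by have := sqr_ge0 (4 * (1 - x) + 3); rewrite /d; nra.
have -> : eisn x (2 * x * (2 - x)) = x ^+ 2 * d by rewrite /d /eisn; ring.
rewrite sqrtrM ?sqr_ge0 // sqrtr_sqr ger0_norm ?ltW //.
have s0 : Num.sqrt d != 0 by rewrite gt_eqF // sqrtr_gt0.
by field; rewrite s0 gt_eqF.
Qed.

Lemma gap_orbit_tie {x y z : nat -> R} : gap_orbit x y z ->
  ordered (x 0) (y 0) (z 0) -> x 0 = y 0 -> y 0 < z 0 ->
  [/\ x k @[k --> \oo] --> (1 : R), y k @[k --> \oo] --> (1 : R)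
    & z k @[k --> \oo] --> (2 : R)].
Proof.
move=> orb o0 xy0 yz0; have o := gap_orbit_ordered orb o0.
have xy k : y k = x k.
  by elim: k => // k IHk; have [-> -> _] := orb k; rewrite IHk.
have xp k : 0 < x k by rewrite -xy; have [] := o k.
have zE k : z k.+1 = 2 * x k.+1 * (2 - x k.+1).
  have [-> _ ->] := orb k; rewrite !xy; apply: gap_tie_base => //.
  by have [? ? ? _] := o k; lra.
pose b k := 1 - x k.+1.
pose d t : R := 4 * t ^+ 2 + 6 * t + 3.
have b0 : - (1 / 2) < b 0.
  rewrite /b; have [-> _ _] := orb 0; rewrite xy -ltrBlDl.
  by have := gap_tie_lt (xp 0) (_ : x 0 < z 0); rewrite -xy; lra.
(* Either b starts nonnegative and stays so, or it increases to 0: in both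
   cases b >= m throughout, so that d b >= d m > 1. *)
pose m := Num.min (b 0) 0.
have m12 : - (1 / 2) < m by rewrite /m lt_min b0; lra.
have m0 : m <= 0 by rewrite /m ge_min lexx orbT.
have dm t : m <= t -> d m <= d t by rewrite /d => mt; nra.
have dm1 : 1 < d m by rewrite /d; nra.
pose q := (Num.sqrt (d m))^-1.
have sm1 : 1 < Num.sqrt (d m) by rewrite -[ltLHS]sqrtr1 ltr_sqrt //; lra.
have q0 : 0 < q by rewrite invr_gt0; lra.
have q1 : q < 1 by rewrite invf_lt1 //; lra.
have bS k : m <= b k -> b k.+1 = b k / Num.sqrt (d (b k)).
  move=> mb; rewrite /b; have [-> _ _] := orb k.+1; rewrite xy zE.
  by apply: gap_tie_step => //; move: mb; rewrite /b; lra.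
have sq k : m <= b k -> (Num.sqrt (d (b k)))^-1 <= q.
  move=> mb; rewrite lef_pV2 ?posrE ?sqrtr_gt0; last by lra.
    by rewrite ler_wsqrtr // dm.
  by have := dm _ mb; lra.
have bm k : m <= b k.
  elim: k => [|k IHk]; first by rewrite /m ge_min lexx.
  rewrite bS //; have s := sq k IHk.
  have [bp|bn] := lerP 0 (b k).
    by apply: le_trans m0 _; rewrite divr_ge0 // sqrtr_ge0.
  apply: le_trans IHk _; rewrite ler_nMr //; lra.
have bq k : `|b k| <= q ^+ k * `|b 0|.
  elim: k => [|k IHk]; first by rewrite expr0 mul1r.
  rewrite bS // normrM exprS -mulrA mulrC.
  apply: ler_pM => //.
  by rewrite ger0_norm ?sq // invr_ge0 sqrtr_ge0.
have blim : b k @[k --> \oo] --> (0 : R).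
  apply/norm_cvg0P.
  apply: (@squeeze_cvgr _ _ _ _ (cst 0) (fun k => q ^+ k * `|b 0|)).
  - by near=> k; rewrite bq normr_ge0.
  - exact: cvg_cst.
  - rewrite -[X in _ --> X](mul0r `|b 0|); apply: cvgMl.
    by apply: cvg_expr; rewrite ger0_norm // ltW.
have xlim : x k @[k --> \oo] --> (1 : R).
  apply/cvg_succ; have -> : (fun k => x k.+1) = (fun k => 1 - b k).
    by apply/funext => k; rewrite /b; ring.
  rewrite -[X in _ --> X](subr0 1); apply: cvgB => //; exact: cvg_cst.
have yE : y = x by apply/funext.
rewrite yE; split=> //; apply/cvg_succ.
have -> : (fun k => z k.+1) = (fun k => 2 * x k.+1 * (2 - x k.+1)).
  exact/funext.
have x1 : x k.+1 @[k --> \oo] --> (1 : R) by apply/(cvg_succ x).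
have h1 : 2 * x k.+1 @[k --> \oo] --> (2 * 1 : R).
  by apply: cvgMr; exact: x1.
have h2 : 2 - x k.+1 @[k --> \oo] --> (2 - 1 : R).
  by apply: cvgB; [exact: cvg_cst|exact: x1].
have -> : nbhs (2 : R) = nbhs (2 * 1 * (2 - 1) : R) by congr nbhs; ring.
exact: cvgM h1 h2.
Unshelve. all: by end_near. Qed.

Lemma gap_orbit_equal {x y z : nat -> R} : gap_orbit x y z ->
  ordered (x 0) (y 0) (z 0) -> x 0 = y 0 -> y 0 = z 0 ->
  [/\ x k @[k --> \oo] --> (3 / 2 : R), y k @[k --> \oo] --> (3 / 2 : R)
    & z k @[k --> \oo] --> (3 / 2 : R)].
Proof.
move=> orb o0 xy0 yz0; have o := gap_orbit_ordered orb o0.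
have xyz k : y k = x k /\ z k = x k.
  elim: k => [|k [yE zE]]; first by rewrite -yz0 xy0.
  by have [-> -> ->] := orb k; rewrite yE zE.
have xS k : x k.+1 = 3 / 2.
  have [-> _ _] := orb k; have [yE zE] := xyz k; rewrite yE zE gap_equal //.
  by rewrite -yE; have [] := o k.
have -> : y = x by apply/funext => k; have [] := xyz k.
have -> : z = x by apply/funext => k; have [] := xyz k.
have xlim : x k @[k --> \oo] --> (3 / 2 : R).
  apply/cvg_succ; have -> : (fun k => x k.+1) = cst (3 / 2) by exact/funext.
  exact: cvg_cst.
by split.
Qed.

(** * The limits, and all orbits by symmetry *)

(** At most one gap vanishes; for nonnegative gaps this says that no row is
constant. *)
Definition noncoincident x y z :=
  [/\ 0 <= x, 0 <= y & 0 <= z] /\ [/\ 0 < x + y, 0 < x + z & 0 < y + z].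

Inductive limit_gaps : R -> R -> R -> Prop :=
| LimitEquilateral : limit_gaps (3 / 2) (3 / 2) (3 / 2)
| LimitRight1 : limit_gaps 2 1 1
| LimitRight2 : limit_gaps 1 2 1
| LimitRight3 : limit_gaps 1 1 2
| LimitDouble1 : limit_gaps 0 2 2
| LimitDouble2 : limit_gaps 2 0 2
| LimitDouble3 : limit_gaps 2 2 0.

Lemma limit_gaps_noncoincident x y z :
  limit_gaps x y z -> noncoincident x y z.
Proof. by case; split; split; lra. Qed.

Lemma limit_gaps_fixed x y z : limit_gaps x y z ->
  [/\ gap x y z = x, gap y x z = y & gap z x y = z].
Proof.
have leg : gap 1 1 2 = 1.
  by rewrite gap_tie_leg // mulr1 subrr mul0r subr0.
have base : gap 2 1 1 = 2.
  by rewrite gap_tie_base // leg; ring.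
have e (t : R) : 0 <= t -> Num.sqrt (t ^+ 2) = t.
  by move=> t0; rewrite sqrtr_sqr ger0_norm.
have e02 : eisn 0 2 = 2 ^+ 2 by rewrite /eisn; ring.
have e22 : eisn 2 2 = 2 ^+ 2 by rewrite /eisn; ring.
have short : gap 0 2 2 = 0.
  by rewrite /gap e02 e // /eisdot; field.
have long : gap 2 0 2 = 2.
  by rewrite /gap (eisnC 2 0) e02 e22 e // /eisdot; field.
have eq := @gap_equal (3 / 2).
have leg' : gap 1 2 1 = 1 by rewrite gapC.
have long' : gap 2 2 0 = 2 by rewrite gapC.
by case; split=> //; apply: eq; lra.
Qed.

Definition settles (x y z : nat -> R) :=
  (forall k, noncoincident (x k) (y k) (z k)) /\
  exists lx ly lz, limit_gaps lx ly lz /\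
    [/\ x k @[k --> \oo] --> lx, y k @[k --> \oo] --> ly
      & z k @[k --> \oo] --> lz].

Lemma settles_swap12 {x y z : nat -> R} : settles x y z -> settles y x z.
Proof.
case=> nc [lx [ly [lz [L [xl yl zl]]]]]; split.
  by move=> k; have [[? ? ?] [? ? ?]] := nc k; split; split=> //; rewrite addrC.
by exists ly, lx, lz; split=> //; case: L; constructor.
Qed.

Lemma settles_swap23 {x y z : nat -> R} : settles x y z -> settles x z y.
Proof.
case=> nc [lx [ly [lz [L [xl yl zl]]]]]; split.
  by move=> k; have [[? ? ?] [? ? ?]] := nc k; split; split=> //; rewrite addrC.
by exists lx, lz, ly; split=> //; case: L; constructor.
Qed.

Lemma gap_orbit_swap12 {x y z : nat -> R} : gap_orbit x y z -> gap_orbit y x z.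
Proof.
by move=> orb k; have [-> -> ->] := orb k; split=> //; exact: gapC.
Qed.

Lemma gap_orbit_swap23 {x y z : nat -> R} : gap_orbit x y z -> gap_orbit x z y.
Proof.
by move=> orb k; have [-> -> ->] := orb k; split=> //; exact: gapC.
Qed.

Lemma ordered_orbit_settles {x y z : nat -> R} : gap_orbit x y z ->
  ordered (x 0) (y 0) (z 0) -> settles x y z.
Proof.
move=> orb o0; split.
  move=> k; have [? ? ? ?] := gap_orbit_ordered orb o0 k.
  by split; split; lra.
have [_ + + _] := o0.
rewrite le_eqVlt => /predU1P[xy|xy _]; last first.
  exists 0, 2, 2; split; first by constructor.
  exact: gap_orbit_strict.
rewrite le_eqVlt => /predU1P[yz|yz].
  exists (3 / 2), (3 / 2), (3 / 2); split; first by constructor.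
  exact: gap_orbit_equal.
exists 1, 1, 2; split; first by constructor.
exact: gap_orbit_tie.
Qed.

Lemma gap_orbit_settles (x y z : nat -> R) : gap_orbit x y z ->
  noncoincident (x 0) (y 0) (z 0) -> settles x y z.
Proof.
wlog xy : x y / x 0 <= y 0 => [H orb nc|].
  have [xy|/ltW yx] := lerP (x 0) (y 0); first exact: H.
  apply/settles_swap12/H => //; first exact: gap_orbit_swap12.
  by case: nc => [[? ? ?] [? ? ?]]; split; split=> //; rewrite addrC.
move=> orb [[x0 y0 z0] [xy0 xz0 yz0]].
have [yz|/ltW zy] := lerP (y 0) (z 0).
  by apply: ordered_orbit_settles => //; split=> //; lra.
have orb' := gap_orbit_swap23 orb.
have [xz|/ltW zx] := lerP (x 0) (z 0).
  apply/settles_swap23/ordered_orbit_settles => //; split=> //; lra.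
apply/settles_swap23/settles_swap12/ordered_orbit_settles.
  exact: gap_orbit_swap12.
by split=> //; lra.
Qed.

Lemma gap_orbit_exists x y z : exists u v w : nat -> R,
  [/\ u 0 = x, v 0 = y, w 0 = z & gap_orbit u v w].
Proof.
pose step (t : R * R * R) := let: (x, y, z) := t in
  (gap x y z, gap y x z, gap z x y).
pose t k := iter k step (x, y, z).
exists (fun k => (t k).1.1), (fun k => (t k).1.2), (fun k => (t k).2).
by split=> // k; rewrite /t iterS; case: (iter _ _ _) => [[]].
Qed.

(** * Back to matrices *)

Definition gapmx x y z : 'M[R]_3 := Amx (1 - z) (1 - y) (1 - x).

Definition csum (u v : 'rV[R]_3) : R :=
  \sum_k (u 0 k - mean u) * (v 0 k - mean v).

Lemma csum_gapmx x y z (i j : 'I_3) :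
  csum (row i (gapmx x y z)) (row j (gapmx x y z)) = 2 / 3 *
  nth 0 (nth [::] [:: [:: eisn y z; eisdot z x y; eisdot y x z];
                      [:: eisdot z x y; eisn x z; eisdot x y z];
                      [:: eisdot y x z; eisdot x y z; eisn x y]] i) j.
Proof.
rewrite /csum /mean !big_ord_recl !big_ord0 !mxE /=.
case: i => [[|[|[|//]]] ?]; case: j => [[|[|[|//]]] ?] /=;
  by rewrite /eisn /eisdot; field.
Qed.

Lemma corr_scaled (e f m : R) : 0 <= e -> 0 <= f ->
  2 / 3 * m / Num.sqrt ((2 / 3 * e) * (2 / 3 * f)) =
  m / (Num.sqrt e * Num.sqrt f).
Proof.
move=> e0 f0; rewrite mulrACA -expr2 sqrtrM ?sqr_ge0 // sqrtr_sqr.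
rewrite sqrtrM // ger0_norm; last by lra.
by rewrite -mulf_div divff ?mul1r //; lra.
Qed.

Lemma corrmx_gapmx x y z : noncoincident x y z ->
  corrmx (gapmx x y z) = gapmx (gap x y z) (gap y x z) (gap z x y).
Proof.
case=> [[x0 y0 z0] [xy0 xz0 yz0]].
have /ltW nxy := eisn_gt0 x0 y0 xy0.
have /ltW nxz := eisn_gt0 x0 z0 xz0.
have /ltW nyz := eisn_gt0 y0 z0 yz0.
have [sxy _] := sqrt_eisn x0 y0 xy0.
have [sxz _] := sqrt_eisn x0 z0 xz0.
have [syz _] := sqrt_eisn y0 z0 yz0.
have self (e : R) : 0 <= e -> 0 < Num.sqrt e ->
    e / (Num.sqrt e * Num.sqrt e) = 1.
  by move=> e0 s0; rewrite -expr2 sqr_sqrtr // divff // gt_eqF // -sqrtr_gt0.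
apply/matrixP => i j; rewrite !mxE /corr -/(csum _ _).
rewrite -[\sum_k (_ - mean (row i _)) ^+ 2]/(csum _ _).
rewrite -[\sum_k (_ - mean (row j _)) ^+ 2]/(csum _ _).
rewrite !csum_gapmx /gap (eisnC y x) (eisnC z x) (eisnC z y).
case: i => [[|[|[|//]]] ?]; case: j => [[|[|[|//]]] ?] /=;
  rewrite corr_scaled // ?self //; rewrite opprB addrC subrK //;
  by rewrite [Num.sqrt _ * _]mulrC.
Qed.

Lemma nonconstant_rows_gapmx x y z :
  noncoincident x y z -> nonconstant_rows (gapmx x y z).
Proof.
case=> [[x0 y0 z0] [xy0 xz0 yz0]].
pose i1 : 'I_3 := lift ord0 ord0; pose i2 : 'I_3 := lift ord0 (lift ord0 ord0).
case=> [[|[|[|//]]] ?].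
- have [y00|] := eqVneq y 0.
    by exists ord0, i1; rewrite !mxE /=; lra.
  by move/eqP => ?; exists ord0, i2; rewrite !mxE /=; lra.
- have [x00|] := eqVneq x 0.
    by exists i1, ord0; rewrite !mxE /=; lra.
  by move/eqP => ?; exists i1, i2; rewrite !mxE /=; lra.
- have [x00|] := eqVneq x 0.
    by exists i2, ord0; rewrite !mxE /=; lra.
  by move/eqP => ?; exists i2, i1; rewrite !mxE /=; lra.
Qed.

Lemma corr_orbit_gapmx {x y z : nat -> R} : gap_orbit x y z ->
  (forall k, noncoincident (x k) (y k) (z k)) ->
  forall k, corr_orbit (gapmx (x 0) (y 0) (z 0)) k = gapmx (x k) (y k) (z k).
Proof.
move=> orb nc; elim=> // k IHk.
rewrite /corr_orbit iterS -/(corr_orbit _ k) IHk.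
by rewrite corrmx_gapmx //; have [-> -> ->] := orb k.
Qed.

(** The topology on matrices is the product topology, and there are finitely
many entries. *)
Lemma cvg_mx m n (M : nat -> 'M[R]_(m, n)) (L : 'M[R]_(m, n)) :
  (forall i j, M k i j @[k --> \oo] --> L i j) -> M k @[k --> \oo] --> L.
Proof.
move=> ML; apply/cvg_mx_entourageP => A entA.
have near_row i : \forall k \near \oo, forall j, (L i j, M k i j) \in A.
  apply: (@filter_forall _ _ (fun j k => (L i j, M k i j) \in A)) => j.
  have /cvg_entourageP /(_ A entA) AML := ML i j.
  by near=> k; rewrite inE; near: k; exact: AML.
change (\forall k \near \oo, forall i j, (L i j, M k i j) \in A).
apply: (@filter_forall _ _ (fun i k => forall j, (L i j, M k i j) \in A)) => i.
exact: near_row.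
Unshelve. all: by end_near. Qed.

Lemma cvg_gapmx (x y z : nat -> R) (lx ly lz : R) :
  x k @[k --> \oo] --> lx -> y k @[k --> \oo] --> ly ->
  z k @[k --> \oo] --> lz ->
  gapmx (x k) (y k) (z k) @[k --> \oo] --> gapmx lx ly lz.
Proof.
move=> xl yl zl; apply: cvg_mx => i j.
have sub1 (u : nat -> R) l : u k @[k --> \oo] --> l ->
    1 - u k @[k --> \oo] --> 1 - l.
  by move=> ul; apply: cvgB => //; exact: cvg_cst.
have one : (fun=> 1 : R) @ \oo --> (1 : R) by exact: cvg_cst.
under eq_fun do rewrite mxE; rewrite mxE.
by case: i => [[|[|[|//]]] ?]; case: j => [[|[|[|//]]] ?] /=; do ?exact: sub1.
Qed.

Lemma limit_matricesP (L : 'M[R]_3) : limit_matrices L <->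
  exists x y z, limit_gaps x y z /\ L = gapmx x y z.
Proof.
have E x y z a b c : a = 1 - z -> b = 1 - y -> c = 1 - x ->
  Amx a b c = gapmx x y z by move=> -> -> ->.
rewrite /limit_matrices /= !inE.
have -> : Amx (- 2^-1) (- 2^-1) (- 2^-1) = gapmx (3 / 2) (3 / 2) (3 / 2).
  by apply: E; field.
have -> : Amx 1 (- 1) (- 1) = gapmx 2 2 0 by apply: E; ring.
have -> : Amx (- 1) 1 (- 1) = gapmx 2 0 2 by apply: E; ring.
have -> : Amx (- 1) (- 1) 1 = gapmx 0 2 2 by apply: E; ring.
have -> : Amx (- 1) 0 0 = gapmx 1 1 2 by apply: E; ring.
have -> : Amx 0 (- 1) 0 = gapmx 1 2 1 by apply: E; ring.
have -> : Amx 0 0 (- 1) = gapmx 2 1 1 by apply: E; ring.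
split=> [|[x [y [z [l ->]]]]]; last by case: l; rewrite eqxx ?orbT.
by do ?[case/orP]; move=> /eqP ->; do 3 eexists; split=> //; constructor.
Qed.

(** Positive semidefiniteness, tested on differences of basis vectors, bounds
the entries by 1, so the gaps are nonnegative. *)
Lemma C3nd_gapmx (P : 'M[R]_3) : C3nd P ->
  exists x y z, noncoincident x y z /\ P = gapmx x y z.
Proof.
case=> [[Psym Ppsd P1] Pnc].
pose i1 : 'I_3 := lift ord0 ord0; pose i2 : 'I_3 := lift ord0 (lift ord0 ord0).
have sym i j : P i j = P j i by rewrite -{1}Psym mxE.
have le1 i j : 0 <= 1 - P i j.
  have := Ppsd (delta_mx 0 i - delta_mx 0 j).
  rewrite linearB /= !trmx_delta mulmxBl mulmxBr !mulmxBl.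
  rewrite -!rowE -!colE !mxE !P1 (sym j i); lra.
have PE : P = gapmx (1 - P i1 i2) (1 - P ord0 i2) (1 - P ord0 i1).
  have o0 (h : (0 < 3)%N) : Ordinal h = ord0 by apply: val_inj.
  have o1 (h : (1 < 3)%N) : Ordinal h = i1 by apply: val_inj.
  have o2 (h : (2 < 3)%N) : Ordinal h = i2 by apply: val_inj.
  apply/matrixP => i j; rewrite !mxE !subKr.
  by case: i => [[|[|[|//]]] ?]; case: j => [[|[|[|//]]] ?];
    rewrite ?o0 ?o1 ?o2 ?P1 //= sym.
move: PE (le1 i1 i2) (le1 ord0 i2) (le1 ord0 i1).
set x := 1 - P i1 i2; set y := 1 - P ord0 i2; set z := 1 - P ord0 i1.
move=> PE x0 y0 z0; exists x, y, z; split=> //; split=> //.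
have pos (s t : R) : 0 <= s -> 0 <= t -> ~ (s = 0 /\ t = 0) -> 0 < s + t.
  move=> s0 t0 st; rewrite lt_neqAle addr_ge0 // andbT eq_sym paddr_eq0 //.
  by apply/negP => /andP[/eqP ? /eqP ?]; apply: st.
have nc i : nonconstant (row i (gapmx x y z)) by rewrite -PE.
split; apply: pos => // -[s0 t0].
- have [k [l]] := nc i2; apply; rewrite !mxE s0 t0.
  by case: k => [[|[|[|//]]] ?]; case: l => [[|[|[|//]]] ?] /=; lra.
- have [k [l]] := nc i1; apply; rewrite !mxE s0 t0.
  by case: k => [[|[|[|//]]] ?]; case: l => [[|[|[|//]]] ?] /=; lra.
- have [k [l]] := nc ord0; apply; rewrite !mxE s0 t0.
  by case: k => [[|[|[|//]]] ?]; case: l => [[|[|[|//]]] ?] /=; lra.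
Qed.

End GapDynamics.

Theorem theorem5 (R : realType) :
  (forall P0 : 'M[R]_3, C3nd P0 ->
     (forall k : nat, nonconstant_rows (corr_orbit P0 k)) /\
     (exists2 L : 'M[R]_3, limit_matrices L &
        corr_orbit P0 k @[k --> \oo] --> L)) /\
  (forall L : 'M[R]_3, limit_matrices L -> fixed_point L).
Proof.
split=> [P0 /C3nd_gapmx[x [y [z [nc0 ->]]]]|L].
  have [u [v [w [u0 v0 w0 orb]]]] := gap_orbit_exists R x y z.
  rewrite -u0 -v0 -w0 in nc0 *.
  have [nc [lx [ly [lz [L [ul vl wl]]]]]] := gap_orbit_settles R u v w orb nc0.
  have orbE := corr_orbit_gapmx R orb nc.
  split=> [k|]; first by rewrite orbE; exact: nonconstant_rows_gapmx.
  exists (gapmx R lx ly lz); first by apply/limit_matricesP; exists lx, ly, lz.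
  by under eq_fun do rewrite orbE; exact: cvg_gapmx.
move=> /limit_matricesP[x [y [z [l ->]]]].
have nc := limit_gaps_noncoincident R x y z l.
split; first exact: nonconstant_rows_gapmx.
by rewrite corrmx_gapmx //; have [-> -> ->] := limit_gaps_fixed R x y z l.
Qed.
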